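(* There are non-isomorphic graphs $G$, $H$ such that the system of linear equations $\operatorname{MLIN}(\mathsf P_{\mathrm{iso}}(G,H)^2)$ has a solution over $\mathbb Z$ (i.e. an integer assignment to its variables satisfying all its equations).
   Context: A local isomorphism from $G$ to $H$ is an injective map $\pi$ with domain contained in $V(G)$ and range in $V(H)$ (viewed as a subset of $V(G)\times V(H)$) such that $vv'\in E(G)\iff\pi(v)\pi(v')\in E(H)$ for all $v,v'$ in its domain. Standing assumption: $|V(G)|\ge2$ or $|V(H)|\ge 2$. $\mathsf P_{\mathrm{iso}}(G,H)$ is the set of polynomials (each $p$ standing for $p=0$) in variables $x_{vw}$ ($v\in V(G)$, $w\in V(H)$): $\sum_{v\in V(G)}x_{vw}-1$ for all $w\in V(H)$; $\sum_{w\in V(H)}x_{vw}-1$ for all $v\in V(G)$; $x_{vw}x_{v'w'}$ for all $v,v',w,w'$ such that $\{(v,w),(v',w')\}$ is not a local isomorphism. For a set $\mathsf P$ of polynomials, $\mathsf P^r$ is the set of all polynomials of degree at most $r$ obtained by multiplying a polynomial of $\mathsf P$ by a monomial (including the monomial $1$). $\operatorname{MLIN}(\mathsf P)$ is the system of linear equations obtained by replacing each monomial $x_{i_1}\cdots x_{i_\ell}$ by a new variable $X_{\{i_1,\dots,i_\ell\}}$ (indexed by the set of variables occurring, so e.g. $x_i^2$ becomes $X_{\{i\}}$), constants being kept; each resulting linear polynomial is set equal to $0$. *)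

(* Defs.v *)
From HB Require Import structures.
From mathcomp Require Import all_boot all_order all_algebra.
From mathcomp Require Import mpoly.

Set Implicit Arguments.
Unset Strict Implicit.
Unset Printing Implicit Defensive.

Import GRing.Theory.
Local Open Scope ring_scope.

Record sgraph := SGraph {
  vertex :> finType;
  adj : rel vertex;
  adj_sym : ssrbool.symmetric adj;
  adj_irrefl : irreflexive adj
}.

Definition graph_iso (G H : sgraph) : Prop :=
  exists f : G -> H,
    bijective f /\ forall v v' : G, adj (f v) (f v') = adj v v'.

(* A partial map from G to H is identified with its graph, a set of pairs. *)
Definition local_iso (G H : sgraph) (S : {set G * H}) : Prop :=
  [/\ forall v w w', (v, w) \in S -> (v, w') \in S -> w = w',
      forall v v' w, (v, w) \in S -> (v', w) \in S -> v = v' &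
      forall v v' w w', (v, w) \in S -> (v', w') \in S ->
        adj v v' = adj w w'].

(* Number of variables x_{vw}; the variable x_{vw} is 'X_i with i the rank of
   the pair (v, w) in the enumeration of the finite type G * H. *)
Definition nvar (G H : sgraph) : nat := #|{: G * H}|.

Definition xvar (G H : sgraph) (v : G) (w : H) : {mpoly int[nvar G H]} :=
  'X_(enum_rank (v, w)).

Inductive Piso (G H : sgraph) : {mpoly int[nvar G H]} -> Prop :=
| Piso_col (w : H) : Piso ((\sum_(v : G) xvar v w) - 1)
| Piso_row (v : G) : Piso ((\sum_(w : H) xvar v w) - 1)
| Piso_mul (v v' : G) (w w' : H) :
    ~ local_iso [set (v, w); (v', w')] -> Piso (xvar v w * xvar v' w').

Section MLIN.
Variable n : nat.
Implicit Types (P : {mpoly int[n]} -> Prop) (p q : {mpoly int[n]}).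

(* P^r; msize is the total degree plus one (and 0 for the zero polynomial). *)
Definition pow_sys P (r : nat) q : Prop :=
  exists p (m : 'X_{1..n}),
    [/\ P p, q = p * 'X_[m] & (msize q <= r.+1)%N].

Definition mvars (m : 'X_{1..n}) : {set 'I_n} := [set i | m i != 0%N].

(* The variables X_S, for S a set of the original variables; X_set0 exists as a
   variable but is never produced by mlin, which keeps constants. *)
Definition nXvar : nat := #|{: {set 'I_n}}|.

Definition Xvar (S : {set 'I_n}) : {mpoly int[nXvar]} := 'X_(enum_rank S).

Definition mlin p : {mpoly int[nXvar]} :=
  \sum_(m <- msupp p)
    p@_m *: (if m == 0%MM then 1 else Xvar (mvars m)).

Definition MLIN P (l : {mpoly int[nXvar]}) : Prop :=
  exists2 p, P p & l = mlin p.

End MLIN.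

Definition solution (N : nat) (L : {mpoly int[N]} -> Prop) (a : 'I_N -> int) :
    Prop :=
  forall l, L l -> l.@[a] = 0.

(* Main.v *)
(* We take G = C5 + C11 and H = C7 + C9. In degree 2 a solution is a symmetric
   integer function Y on pairs (v, w), (v', w') that vanishes off the local
   isomorphisms and whose sums over v or over w equal the diagonal value at
   (v', w'). We look for Y invariant under rotating each cycle, so that its
   diagonal is a constant k(C, D) for a cycle C of G and D of H, subject to
   sum_D |D| k(C, D) = 1 and sum_C |C| k(C, D) = 1. As 5, 11, 7, 9 are pairwise
   coprime, these equations have an integer solution. An edge of C is sent to an
   edge of D with the value k(C, D) if the orientations agree and 0 otherwise.
   The remaining values only have to form matrices with prescribed row and
   column sums, chosen by hand. The graphs are not isomorphic since H has no
   closed walk of length 5. *)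
Require Import Defs.
From mathcomp Require Import all_boot all_order all_algebra.
From mathcomp Require Import mpoly.

Set Implicit Arguments.
Unset Strict Implicit.
Unset Printing Implicit Defensive.

Import GRing.Theory.
Local Open Scope ring_scope.

(** * Evaluation of multilinearized polynomials *)

Section MultilinearEvaluation.
Variables (n : nat) (a : {set 'I_n} -> int).

Definition assignment (i : 'I_(nXvar n)) : int := a (enum_val i).

Definition mono_value (m : 'X_{1..n}) : int :=
  if m == 0%MM then 1 else a (mvars m).

Definition mlin_value (p : {mpoly int[n]}) : int :=
  \sum_(m <- msupp p) p@_m * mono_value m.

Lemma mlin_eval p : (mlin p).@[assignment] = mlin_value p.
Proof.
rewrite /mlin raddf_sum; apply: eq_bigr => m _ /=.
rewrite mevalZ /mono_value; case: ifP => _; first by rewrite meval1.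
by rewrite /Xvar mevalXU /assignment enum_rankK.
Qed.

(** Monomials outside the support contribute 0, so one list can serve [p], [q] and [p + q], whose
    supports differ. *)
Lemma mlin_valueE (s : seq 'X_{1..n}) p :
  uniq s -> {subset msupp p <= s} ->
  mlin_value p = \sum_(m <- s) p@_m * mono_value m.
Proof.
move=> us sub; rewrite [RHS](bigID (mem (msupp p))) /= [X in _ + X]big1 ?addr0.
  rewrite -big_filter; apply: perm_big; apply: uniq_perm; rewrite ?msupp_uniq //.
    exact: filter_uniq.
  move=> m; rewrite mem_filter; case: (boolP (m \in msupp p)) => // /sub -> //.
by move=> m /memN_msupp_eq0 ->; rewrite mul0r.
Qed.

Lemma mlin_valueD p q : mlin_value (p + q) = mlin_value p + mlin_value q.
Proof.
pose s := undup (msupp (p + q) ++ msupp p ++ msupp q).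
have us : uniq s by exact: undup_uniq.
rewrite !(mlin_valueE us); last first.
- by move=> m mp; rewrite mem_undup mem_cat mp.
- by move=> m mp; rewrite mem_undup !mem_cat mp !orbT.
- by move=> m mp; rewrite mem_undup !mem_cat mp !orbT.
by rewrite -big_split; apply: eq_bigr => m _; rewrite mcoeffD mulrDl.
Qed.

Lemma mlin_value0 : mlin_value 0 = 0.
Proof. by rewrite /mlin_value msupp0 big_nil. Qed.

Lemma mlin_valueN p : mlin_value (- p) = - mlin_value p.
Proof.
by apply/eqP; rewrite -addr_eq0 -mlin_valueD addNr mlin_value0.
Qed.

Lemma mlin_value_sum (I : finType) (f : I -> {mpoly int[n]}) :
  mlin_value (\sum_i f i) = \sum_i mlin_value (f i).
Proof. exact: (big_morph _ mlin_valueD mlin_value0). Qed.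

Lemma mlin_valueX m : mlin_value 'X_[m] = mono_value m.
Proof. by rewrite /mlin_value msuppX big_seq1 mcoeffX eqxx mul1r. Qed.

End MultilinearEvaluation.

Lemma mvarsU n (i : 'I_n) : mvars U_(i) = [set i].
Proof.
by apply/setP=> k; rewrite !inE mnm1E eqb0 negbK eq_sym.
Qed.

Lemma mvarsUU n (i j : 'I_n) : mvars (U_(i) + U_(j))%MM = [set i; j].
Proof.
apply/setP=> k; rewrite !inE mnmDE !mnm1E addn_eq0 !eqb0 negb_and !negbK.
by rewrite ![k == _]eq_sym.
Qed.

Lemma mdeg_le1 n (m : 'X_{1..n}) :
  (mdeg m <= 1)%N -> m = 0%MM \/ exists j, m = U_(j)%MM.
Proof.
rewrite leq_eqVlt ltnS leqn0 mdeg_eq0 => /orP[|/eqP]; last by left.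
by move=> /mdeg1P[j /eqP ->]; right; exists j.
Qed.

(** * Assignments given by a symmetric function of two indices *)

Section PairAssignment.
Variables (n : nat) (F : 'I_n -> 'I_n -> int).
Hypothesis F_sym : forall i j, F i j = F j i.

(** A singleton is [[set i; i]], so it receives [F i i]; [F_sym] makes the order of the picked pair
    immaterial. *)
Definition pair_assignment (S : {set 'I_n}) : int :=
  if [pick p : 'I_n * 'I_n | S == [set p.1; p.2]] is Some p
  then F p.1 p.2 else 0.

Lemma pair_assignmentE i j : pair_assignment [set i; j] = F i j.
Proof.
rewrite /pair_assignment; case: pickP => [[k l] /= /eqP e|/(_ (i, j))];
  last by rewrite eqxx.
have ik : i \in [set k; l] by rewrite -e set21.
have jk : j \in [set k; l] by rewrite -e set22.
have ki : k \in [set i; j] by rewrite e set21.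
have li : l \in [set i; j] by rewrite e set22.
move: ik jk ki li; rewrite !inE.
by do 4![case/orP=> /eqP ?]; subst=> //; rewrite F_sym.
Qed.

Lemma mono_value1 i : mono_value pair_assignment U_(i) = F i i.
Proof. by rewrite /mono_value mnm1_eq0 mvarsU -[[set i]]setUid pair_assignmentE. Qed.

Lemma mono_value2 i j : mono_value pair_assignment (U_(i) + U_(j)) = F i j.
Proof.
by rewrite /mono_value mnmD_eq0 mnm1_eq0 mvarsUU pair_assignmentE.
Qed.

(** The degree bound leaves the multipliers 1 and $x_j$, which give the two hypotheses on sums. *)
Lemma mlin_value_linear (K : finType) (g : K -> 'I_n) (k0 : K) m :
    injective g ->
    \sum_k F (g k) (g k) = 1 ->
    (forall j, \sum_k F (g k) j = F j j) ->
    (msize (((\sum_k 'X_(g k)) - 1) * 'X_[m] : {mpoly int[n]}) <= 3)%N ->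
  mlin_value pair_assignment (((\sum_k 'X_(g k)) - 1) * 'X_[m]) = 0.
Proof.
move=> g_inj sum1 sumF szq.
have m_le1 : (mdeg m <= 1)%N.
  (* This monomial cannot cancel, as [g] is injective and [m] has smaller degree; hence $\deg m + 1
     \le 2$. *)
  have supp : (m + U_(g k0))%MM \in
      msupp (((\sum_k 'X_(g k)) - 1) * 'X_[m] : {mpoly int[n]}).
    rewrite mcoeff_msupp mcoeffMX mcoeffB mcoeff1 mnm1_eq0 subr0 raddf_sum.
    rewrite (bigD1 k0) //= mcoeffX eqxx big1 ?addr0 // => k kk0.
    rewrite mcoeffX; case: eqP => // /(congr1 (@mvars n)).
    by rewrite !mvarsU => /set1_inj/g_inj e; rewrite e eqxx in kk0.
  have := leq_trans (msize_mdeg_lt supp) szq.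
  by rewrite mdegD mdeg1 addn1.
rewrite mulrBl mul1r mulr_suml mlin_valueD mlin_valueN mlin_value_sum.
rewrite mlin_valueX.
under eq_bigr => k _ do rewrite -mpolyXD mlin_valueX.
apply/eqP; rewrite subr_eq0; apply/eqP.
case: (mdeg_le1 m_le1) => [->|[j ->]].
  rewrite {2}/mono_value eqxx -sum1.
  by apply: eq_bigr => k _; rewrite addm0 mono_value1.
by rewrite mono_value1 -sumF; apply: eq_bigr => k _; rewrite mono_value2.
Qed.

End PairAssignment.

(** * Reduction to an integer function on two vertex pairs *)

Lemma local_iso_pair (G H : sgraph) (v v' : G) (w w' : H) :
  (v == v') = (w == w') -> adj v v' = adj w w' ->
  local_iso [set (v, w); (v', w')].
Proof.
move=> eq_vw adj_vw; split=> [x y y'|x x' y|x x' y y']; rewrite !inE !xpair_eqE.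
- do 2![case/orP=> /andP[/eqP ? /eqP ?]]; subst=> //; apply/eqP;
    by [rewrite -eq_vw|rewrite eq_sym -eq_vw].
- do 2![case/orP=> /andP[/eqP ? /eqP ?]]; subst=> //; apply/eqP;
    by [rewrite eq_vw|rewrite eq_sym eq_vw].
- do 2![case/orP=> /andP[/eqP ? /eqP ?]]; subst=> //;
    by rewrite ?adj_irrefl // adj_sym adj_vw adj_sym.
Qed.

Lemma MLIN_Piso2_solvable (G H : sgraph) (Y : G -> H -> G -> H -> int)
    (v0 : G) (w0 : H) :
    (forall v w v' w', Y v w v' w' = Y v' w' v w) ->
    (forall v w v' w', Y v w v' w' <> 0 ->
       (v == v') = (w == w') /\ adj v v' = adj w w') ->
    (forall w, \sum_v Y v w v w = 1) ->
    (forall v, \sum_w Y v w v w = 1) ->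
    (forall w v' w', \sum_v Y v w v' w' = Y v' w' v' w') ->
    (forall v v' w', \sum_w Y v w v' w' = Y v' w' v' w') ->
  exists a : 'I_(nXvar (nvar G H)) -> int,
    solution (MLIN (pow_sys (@Piso G H) 2)) a.
Proof.
move=> Y_sym Y_supp col1 row1 col2 row2.
pose F (i j : 'I_(nvar G H)) :=
  Y (enum_val i).1 (enum_val i).2 (enum_val j).1 (enum_val j).2.
have F_sym i j : F i j = F j i by exact: Y_sym.
exists (assignment (pair_assignment F)) => _ [_ [p [m [Pp -> szq]]] ->].
rewrite mlin_eval; case: Pp szq => [w|v|v v' w w' nloc] szq.
- apply: (mlin_value_linear F_sym v0) szq.
  + by move=> x y /enum_rank_inj [].
  + by rewrite -[RHS](col1 w); apply: eq_bigr => v _; rewrite /F enum_rankK.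
  + by move=> j; rewrite /F -(col2 w); apply: eq_bigr => v _; rewrite enum_rankK.
- apply: (mlin_value_linear F_sym w0) szq.
  + by move=> x y /enum_rank_inj [].
  + by rewrite -[RHS](row1 v); apply: eq_bigr => w _; rewrite /F enum_rankK.
  + by move=> j; rewrite /F -(row2 v); apply: eq_bigr => w _; rewrite enum_rankK.
(* The product already has degree 2, so the multiplier is 1. *)
have m0 : m = 0%MM.
  apply/eqP; rewrite -mdeg_eq0 -leqn0; move: szq.
  by rewrite /xvar -!mpolyXD msizeX !mdegD !mdeg1.
rewrite m0 mpolyX0 mulr1 /xvar -mpolyXD mlin_valueX mono_value2 //.
rewrite /F !enum_rankK /=; apply/eqP; apply: contra_notT nloc => /eqP.
by move=> /Y_supp[]; apply: local_iso_pair.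
Qed.

(** * Disjoint unions of two cycles *)

Section TwoCycles.
Variables a b : nat.

Definition cycle_next (i : nat) : nat :=
  if (i < a)%N then (i.+1 %% a)%N else (a + (i - a).+1 %% b)%N.

(** Adjacency lives on natural numbers so that finite checks compute; [i != j] excludes the loop of
    a cycle of length 1. *)
Definition cycles_adj (i j : nat) : bool :=
  (i != j) && ((cycle_next i == j) || (cycle_next j == i)).

Lemma cycles_adj_sym : ssrbool.symmetric cycles_adj.
Proof. by move=> i j; rewrite /cycles_adj eq_sym orbC. Qed.

Lemma cycles_adj_irrefl : irreflexive cycles_adj.
Proof. by move=> i; rewrite /cycles_adj eqxx. Qed.

Definition two_cycles : sgraph :=
  @SGraph 'I_(a + b) (fun i j => cycles_adj i j)
    (fun i j => cycles_adj_sym i j) (fun i => cycles_adj_irrefl i).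

End TwoCycles.

(** * Explicit values and their verification by computation *)

Lemma forall_ord_all n (P : pred nat) :
  all P (iota 0 n) -> forall i : 'I_n, P i.
Proof. by move=> /allP h i; apply: h; rewrite mem_iota add0n ltn_ord. Qed.

Lemma sum_ord_foldr n (f : nat -> int) :
  \sum_(i < n) f i = foldr (fun i s => f i + s) 0 (iota 0 n).
Proof.
by rewrite -(big_mkord predT) /index_iota subn0; elim: (iota 0 n) => [|i s IH];
  rewrite ?big_nil // big_cons IH.
Qed.

(* A flag [c] (for G) or [d] (for H) is true on the second cycle of the graph;
   [s] and [t] are differences, along the cycle, of two vertices of G or of H on
   the same cycle. The weights are the numbers k(C, D). *)
Definition weight (c d : bool) : int :=
  match c, d with
  | false, false => 31 | false, true => -24
  | true, false => -14 | true, true => 11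
  end%Z.

(* The row [s - 2] and the column [t - 2] of a matrix stand for the differences
   [s] and [t], which run over the non-adjacent ones. *)
Definition chord_table (c d : bool) : seq (seq int) :=
  match c, d with
  | false, false => [:: [:: 10; 10; 10; 10]; [:: 10; 10; 10; 10]]
  | false, true => [:: [:: -6; -1; -1; -1; -1; -7]; [:: -7; -1; -1; -1; -1; -6]]
  | true, false =>
      [:: [:: -2; -1; -1; -1]; [:: -1; -2; -1; -1]; [:: -4; -3; -4; -3];
          [:: -4; -3; -4; -3]; [:: -3; -4; -3; -4]; [:: -3; -4; -3; -4];
          [:: -1; -1; -2; -1]; [:: -1; -1; -1; -2]]
  | true, true =>
      [:: [:: 3; 3; 3; 3; 3; 3]; [:: 3; 3; 3; 3; 3; 3]; [:: 1; 3; 2; 2; 2; 1];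
          [:: 1; 2; 3; 2; 2; 1]; [:: 1; 2; 2; 3; 2; 1]; [:: 1; 2; 2; 2; 3; 1];
          [:: 3; 3; 3; 3; 3; 3]; [:: 3; 3; 3; 3; 3; 3]]
  end%Z.

Definition glen (c : bool) : nat := if c then 11 else 5.
Definition hlen (d : bool) : nat := if d then 9 else 7.

Definition same_cycles (c d : bool) (s t : nat) : int :=
  if [|| [&& s == 0 & t == 0], [&& s == 1 & t == 1]
       | [&& s == (glen c).-1 & t == (hlen d).-1]]%N then weight c d
  else if [&& 1 < s & 1 < t]%N
  then nth 0 (nth [::] (chord_table c d) (s - 2)) (t - 2)
  else 0.

(** Serves vertices of H on different cycles. These are distinct and non-adjacent, which forces 0 at
    the differences 0 and ±1. *)
Definition same_G (c : bool) (s : nat) : int :=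
  if c then nth 0 [:: 0; 0; -1; -1; 0; 0; 0; 0; -1; -1; 0]%Z s
  else nth 0 [:: 0; 0; -1; -1; 0]%Z s.

Definition same_H (d : bool) (t : nat) : int :=
  if d then nth 0 [:: 0; 0; -1; -2; -2; -2; -2; -1; 0]%Z t
  else nth 0 [:: 0; 0; 1; 1; 1; 1; 0]%Z t.

(** Adding [l] first avoids truncated subtraction when [i] and [j] lie on one cycle, the only case
    used. *)
Definition cycle_diff (l i j : nat) : nat := ((j + l - i) %% l)%N.

(** The constants 3 and -2 complete the sums: as [same_H false] has total 4, $9\cdot3+4=31$ and
    $-9\cdot2+4=-14$ are the weights. *)
Definition pair_value (v w v' w' : nat) : int :=
  let c := (5 <= v)%N in let c' := (5 <= v')%N in
  let d := (7 <= w)%N in let d' := (7 <= w')%N in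
  let s := cycle_diff (glen c) v v' in let t := cycle_diff (hlen d) w w' in
  match c == c', d == d' with
  | true, true => same_cycles c d s t
  | true, false => same_G c s
  | false, true => same_H d t
  | false, false => if c == d then 3%Z else (-2)%Z
  end.

Definition all16 (P : pred nat) : bool := all P (iota 0 16).

Definition sum16 (f : nat -> int) : int :=
  foldr (fun i s => f i + s) 0 (iota 0 16).

(** Only weights occur: $7\cdot31-9\cdot24=1$ and $-7\cdot14+9\cdot11=1$. *)
Lemma sum_pair_value_row1 (v : 'I_16) : \sum_(w < 16) pair_value v w v w = 1.
Proof.
rewrite (sum_ord_foldr 16 (fun w => pair_value v w v w)); apply/eqP.
pose P (x : nat) := sum16 (fun w => pair_value x w x w) == 1.
by apply: (@forall_ord_all 16 P); vm_compute.
Qed.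

(** Here $5\cdot31-11\cdot14=1$ and $-5\cdot24+11\cdot11=1$. *)
Lemma sum_pair_value_col1 (w : 'I_16) : \sum_(v < 16) pair_value v w v w = 1.
Proof.
rewrite (sum_ord_foldr 16 (fun v => pair_value v w v w)); apply/eqP.
pose P (y : nat) := sum16 (fun v => pair_value v y v y) == 1.
by apply: (@forall_ord_all 16 P); vm_compute.
Qed.

(** For a chord of G, a row of [chord_table] and the values on the other cycle of H add up to the
    weight, such as $40-9=31$. *)
Lemma sum_pair_value_row2 (v v' w' : 'I_16) :
  \sum_(w < 16) pair_value v w v' w' = pair_value v' w' v' w'.
Proof.
rewrite (sum_ord_foldr 16 (fun w => pair_value v w v' w')); apply/eqP.
pose P (x x' y' : nat) :=
  sum16 (fun w => pair_value x w x' y') == pair_value x' y' x' y'.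
have /forall_ord_all/(_ v)/forall_ord_all/(_ v')/forall_ord_all :
  all16 (fun x => all16 (fun x' => all16 (P x x'))) by vm_compute.
exact.
Qed.

Lemma sum_pair_value_col2 (w v' w' : 'I_16) :
  \sum_(v < 16) pair_value v w v' w' = pair_value v' w' v' w'.
Proof.
rewrite (sum_ord_foldr 16 (fun v => pair_value v w v' w')); apply/eqP.
pose P (y x' y' : nat) :=
  sum16 (fun v => pair_value v y x' y') == pair_value x' y' x' y'.
have /forall_ord_all/(_ w)/forall_ord_all/(_ v')/forall_ord_all :
  all16 (fun y => all16 (fun x' => all16 (P y x'))) by vm_compute.
exact.
Qed.

(** The exchange negates both differences; each chord matrix is invariant under a half-turn. *)
Lemma pair_value_sym (v w v' w' : 'I_16) :
  pair_value v w v' w' = pair_value v' w' v w.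
Proof.
apply/eqP.
pose P (x y x' y' : nat) := pair_value x y x' y' == pair_value x' y' x y.
have /forall_ord_all/(_ v)/forall_ord_all/(_ w)/forall_ord_all/(_ v')
    /forall_ord_all : all16 (fun x => all16 (fun y => all16 (fun x' =>
      all16 (P x y x')))) by vm_compute.
exact.
Qed.

Lemma pair_value_supp (v w v' w' : 'I_16) : pair_value v w v' w' <> 0 ->
  (v == v') = (w == w') /\ cycles_adj 5 11 v v' = cycles_adj 7 9 w w'.
Proof.
pose P (x y x' y' : nat) := (pair_value x y x' y' == 0) ||
  ((x == x') == (y == y')) && (cycles_adj 5 11 x x' == cycles_adj 7 9 y y').
have /forall_ord_all/(_ v)/forall_ord_all/(_ w)/forall_ord_all/(_ v')
    /forall_ord_all/(_ w') : all16 (fun x => all16 (fun y => all16 (fun x' =>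
      all16 (P x y x')))) by vm_compute.
by case/orP=> [/eqP->|/andP[/eqP ? /eqP ?]].
Qed.

(** * Non-isomorphism and conclusion *)

(** A closed walk of odd length contains an odd cycle, and the cycles here have lengths 7 and 9. *)
Lemma no_closed_5walk (w0 w1 w2 w3 w4 : two_cycles 7 9) :
  ~ [/\ adj w0 w1, adj w1 w2, adj w2 w3, adj w3 w4 & adj w4 w0].
Proof.
(* Extending walks only along edges avoids testing all $16^5$ sequences. *)
pose step (x : nat) (P : pred nat) (y : nat) :=
  if cycles_adj 7 9 x y then P y else true.
have /forall_ord_all/(_ w0)/forall_ord_all/(_ w1) : all16 (fun x0 =>
    all16 (step x0 (fun x1 => all16 (step x1 (fun x2 => all16 (step x2 (fun x3 =>
      all16 (step x3 (fun x4 => ~~ cycles_adj 7 9 x4 x0)))))))))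
  by vm_compute.
rewrite /step => h [] a01 a12 a23 a34 a40; move: h.
rewrite [cycles_adj _ _ _ _]a01 => /forall_ord_all/(_ w2).
rewrite [cycles_adj _ _ _ _]a12 => /forall_ord_all/(_ w3).
rewrite [cycles_adj _ _ _ _]a23 => /forall_ord_all/(_ w4).
by rewrite [X in if X then _ else _]a34 [cycles_adj _ _ _ _]a40.
Qed.

Lemma cycles_5_11_7_9_not_iso : ~ graph_iso (two_cycles 5 11) (two_cycles 7 9).
Proof.
(* The vertices 0 to 4 form the 5-cycle, whose image would be a closed walk. *)
case=> f [_ f_adj]; pose x k : two_cycles 5 11 := inord k : 'I_16.
apply: (@no_closed_5walk (f (x 0)) (f (x 1)) (f (x 2)) (f (x 3)) (f (x 4))).
by rewrite !f_adj /adj /= !inordK.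
Qed.

Theorem theorem5 :
  exists G H : sgraph,
    [/\ (2 <= #|G|)%N \/ (2 <= #|H|)%N,
        ~ graph_iso G H &
        exists a : 'I_(nXvar (nvar G H)) -> int,
          solution (MLIN (pow_sys (@Piso G H) 2)) a].
Proof.
exists (two_cycles 5 11), (two_cycles 7 9); split.
- by left; rewrite card_ord.
- exact: cycles_5_11_7_9_not_iso.
apply: (@MLIN_Piso2_solvable (two_cycles 5 11) (two_cycles 7 9)
          (fun v w v' w' => pair_value v w v' w') ord0 ord0).
- exact: pair_value_sym.
- exact: pair_value_supp.
- exact: sum_pair_value_col1.
- exact: sum_pair_value_row1.
- exact: sum_pair_value_col2.
- exact: sum_pair_value_row2.
Qed.
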